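(* Let $X$ be a (nonempty) latin rumple. The following conditions are equivalent: (1) $X$ is right linear over a group; (2) $X$ is isotopic to a group; (3) $\mathrm{Dis}(X)$ acts regularly on $X$.
   Context: A left quasigroup is a binary algebra $(X,\cdot)$ in which all left translations $L_x:y\mapsto xy$ are bijections of $X$; a quasigroup is one in which also all right translations $R_x:y\mapsto yx$ are bijections. A rumple is a left quasigroup whose squaring map $x\mapsto xx$ is a bijection and which satisfies $(xy)(xz)=(yx)(yz)$ for all $x,y,z$. A latin rumple is a rumple that is a quasigroup. A binary algebra $(G,* )$ is right linear over a group $(G,\circ)$ (on the same set $G$) if there exist a map $\varphi:G\to G$ and an endomorphism $\psi$ of $(G,\circ)$ such that $x*y=\varphi(x)\circ\psi(y)$ for all $x,y\in G$. Binary algebras $(X_1,\cdot_1)$, $(X_2,\cdot_2)$ are isotopic if there are bijections $f,g,h:X_1\to X_2$ with $f(x)\cdot_2 g(y)=h(x\cdot_1 y)$ for all $x,y\in X_1$. $\mathrm{Dis}(X)=\langle L_xL_y^{-1},\,L_x^{-1}L_y:x,y\in X\rangle$, a permutation group on $X$. A permutation group $G$ acts regularly on $X$ if for all $x,y\in X$ there is a unique $g\in G$ with $g(x)=y$. *)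

(* Defs.v *)
From HB Require Import structures.
From mathcomp Require Import all_boot.
From mathcomp Require Import boolp classical_sets.

Set Implicit Arguments.
Unset Strict Implicit.
Unset Printing Implicit Defensive.

Local Open Scope group_scope.
Local Open Scope classical_set_scope.

Definition left_translation (X : magmaType) (x : X) : X -> X := fun y => x * y.
Definition right_translation (X : magmaType) (x : X) : X -> X := fun y => y * x.

Definition is_left_quasigroup (X : magmaType) : Prop :=
  forall x : X, bijective (left_translation x).

Definition is_quasigroup (X : magmaType) : Prop :=
  is_left_quasigroup X /\ forall x : X, bijective (right_translation x).

Definition is_rumple (X : magmaType) : Prop :=
  [/\ is_left_quasigroup X,
      bijective (fun x : X => x * x)
    & forall x y z : X, (x * y) * (x * z) = (y * x) * (y * z)].

Definition is_latin_rumple (X : magmaType) : Prop :=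
  is_rumple X /\ is_quasigroup X.

(* [Group.axioms_ X] is the type of MathComp group structures on the carrier
   of [X]; they come with a choice operator, which every type has classically.
   In the last equation the product on the left is that of [X], the one on the
   right is that of [G]. *)
Definition right_linear_over_group (X : magmaType) : Prop :=
  exists cG : Group.axioms_ X, let G := Group.Pack cG in
  exists (phi : X -> G) (psi : {multiplicative G -> G}),
  forall x y : X, x * y = (phi x * psi y : G).

Definition isotopic (X1 X2 : magmaType) : Prop :=
  exists f g h : X1 -> X2,
    [/\ bijective f, bijective g, bijective h
      & forall x y : X1, f x * g y = h (x * y)].

Definition isotopic_to_group (X : magmaType) : Prop :=
  exists G : groupType, isotopic X G.

Definition mutually_inverse (T : Type) (f g : T -> T) : Prop :=
  cancel f g /\ cancel g f.

Definition is_perm_group (T : Type) (A : set (T -> T)) : Prop :=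
  [/\ forall f, A f -> bijective f,
      A id,
      forall f g, A f -> A g -> A (f \o g)
    & forall f g, A f -> mutually_inverse f g -> A g].

Definition acts_regularly (T : Type) (A : set (T -> T)) : Prop :=
  forall x y : T, exists! g : T -> T, A g /\ g x = y.

(* The maps L_x L_y^{-1} and L_x^{-1} L_y; each inverse is given as a map
   [l] that is a two-sided inverse of the translation. *)
Definition dis_generators (X : magmaType) : set (X -> X) :=
  [set f | exists (x y : X) (l : X -> X),
     mutually_inverse (left_translation y) l /\ f = left_translation x \o l]
  `|` [set f | exists (x y : X) (l : X -> X),
     mutually_inverse (left_translation x) l /\ f = l \o left_translation y].

Definition Dis (X : magmaType) : set (X -> X) :=
  smallest (@is_perm_group X) (@dis_generators X).

(* Main.v *)
Require Import Defs.
From HB Require Import structures.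
From mathcomp Require Import all_boot.
From mathcomp Require Import boolp classical_sets.

(** Isotopic to a group implies regular: if [f x * g y = h (x y)] in a group,
    then [L_x L_y^-1] and [L_x^-1 L_y] are left multiplications of the group
    transported along [h] and along [g].  Both transported families are regular
    groups, and the rumple identity, in the form
    [L_x L_y^-1 = L_{xy}^-1 L_{yx}], puts the first inside the second; regular
    groups that are nested coincide, and the first is exhausted by the
    generators of [Dis X].

    Regular implies right linear: pick [e] and [u] with [u e = e], and transport
    the group structure of [Dis X] to [X] along [d |-> d e].  Then
    [L_x = (L_x L_u^-1) L_u] gives [x y = phi x * L_u y], and [L_u] is an
    endomorphism because it fixes [e] and, again by the rumple identity,
    normalizes [Dis X]. *)

Local Open Scope group_scope.
Local Open Scope classical_set_scope.

Lemma left_right_inverse_eq (A B : Type) (f : A -> B) (g g' : B -> A) :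
  cancel g f -> cancel f g' -> g = g'.
Proof. by move=> gK fK'; apply/funext => y; rewrite -{2}[y]gK fK'. Qed.

(** An element [p] of [B] agrees at [x] with some [q] in [A]; both lie in [B], so uniqueness there
    forces [p = q]. *)
Lemma regular_subset_eq (T : Type) (A B : set (T -> T)) :
  inhabited T -> acts_regularly A -> acts_regularly B -> A `<=` B -> A = B.
Proof.
move=> [x] regA regB sAB; apply/seteqP; split=> // p Bp.
have [q [[Aq qx] _]] := regA x (p x).
have [r [_ runiq]] := regB x (p x).
by rewrite -(runiq p) // (runiq q) //; split=> //; apply: sAB.
Qed.

Section TransportedTranslations.
Variables (G : groupType) (T : Type) (h : T -> G) (h' : G -> T).
Hypotheses (hK : cancel h h') (h'K : cancel h' h).

Definition transported_translations : set (T -> T) :=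
  range (fun c : G => h' \o (fun z => c * z) \o h).

Lemma transported_translations_perm_group :
  is_perm_group transported_translations.
Proof.
have inv c d : c * d = 1 -> cancel (h' \o (fun z => d * z) \o h)
                                    (h' \o (fun z => c * z) \o h).
  by move=> cd x /=; rewrite h'K mulgA cd mul1g hK.
split.
- move=> _ [c _ <-]; exists (h' \o (fun z => c^-1 * z) \o h); apply: inv.
    exact: mulVg.
  exact: mulgV.
- by exists 1 => //; apply/funext => x /=; rewrite mul1g hK.
- move=> _ _ [c _ <-] [d _ <-]; exists (c * d) => //.
  by apply/funext => x /=; rewrite h'K mulgA.
- move=> _ k [c _ <-] [fk kf]; exists c^-1 => //.
  exact: left_right_inverse_eq (inv _ _ (mulgV c)) fk.
Qed.

Lemma transported_translations_regular :
  acts_regularly transported_translations.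
Proof.
move=> x y; exists (h' \o (fun z => h y * (h x)^-1 * z) \o h).
split; first by split; [exists (h y * (h x)^-1) | rewrite /= mulgVK hK].
move=> _ [[c _ <-] /= <-].
by rewrite h'K mulgK.
Qed.

End TransportedTranslations.

Lemma left_quasigroup_inverse (X : magmaType) : is_left_quasigroup X ->
  exists l : X -> X -> X, forall x, mutually_inverse (left_translation x) (l x).
Proof.
move=> hX; have inv x : exists l, mutually_inverse (@left_translation X x) l.
  by have [l xl lx] := hX x; exists l.
by have [l hl] := choice inv; exists l.
Qed.

Section Displacements.
Variables (X : magmaType) (l : X -> X -> X).
Hypothesis hl : forall x, mutually_inverse (left_translation x) (l x).

Let L := @left_translation X.

Let LK x : cancel (L x) (l x). Proof. by case: (hl x). Qed.
Let lK x : cancel (l x) (L x). Proof. by case: (hl x). Qed.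
Let bijL x : bijective (L x). Proof. by exists (l x). Qed.
Let bijl x : bijective (l x). Proof. by exists (L x). Qed.

Lemma left_translation_inverse_unique x k :
  mutually_inverse (left_translation x) k -> k = l x.
Proof. by case=> _ kx; apply: left_right_inverse_eq kx (LK x). Qed.

Lemma dis_generatorsE :
  @dis_generators X = [set f | exists x y, f = L x \o l y]
                  `|` [set f | exists x y, f = l x \o L y].
Proof.
apply/seteqP; split=> f [].
- move=> [x] [y] [k] [/left_translation_inverse_unique -> ->].
  by left; exists x, y.
- move=> [x] [y] [k] [/left_translation_inverse_unique -> ->].
  by right; exists x, y.
- by move=> [x] [y] ->; left; exists x, y, (l y).
- by move=> [x] [y] ->; right; exists x, y, (l x).
Qed.

Lemma Dis_perm_group : is_perm_group (@Dis X).
Proof.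
(* Closure properties pass to the intersection, but bijectivity of its elements needs one group that
   contains the generators: that of all bijections. *)
have bij_group : is_perm_group (@bijective X X).
  split=> //; first by exists id.
  - by move=> f g bf bg; apply: bij_comp.
  - by move=> f g _ [fK gK]; exists f.
split.
- apply: smallest_sub => //; rewrite dis_generatorsE.
  by move=> f [] [x] [y] ->; apply: bij_comp.
- by move=> M [[]].
- move=> f g Df Dg M MP; have [[_ _ MM _] _] := MP.
  by apply: MM; [apply: Df | apply: Dg].
- move=> f g Df fg M MP; have [[_ _ _ MV] _] := MP.
  by apply: MV fg; apply: Df.
Qed.

Lemma Dis_mul_inv x y : @Dis X (L x \o l y).
Proof.
by apply: sub_gen_smallest; rewrite dis_generatorsE; left; exists x, y.
Qed.

Section Rumple.
Hypothesis rumple : forall x y z : X, (x * y) * (x * z) = (y * x) * (y * z).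

(** The rumple identity reads [L_{xy} L_x = L_{yx} L_y]; solve for [L_x L_y^-1]. *)
Lemma mul_inv_inv_mul x y : L x \o l y = l (x * y) \o L (y * x).
Proof.
apply/funext => z /=; rewrite -[z in RHS](lK y).
by rewrite /L {2}/left_translation -rumple LK.
Qed.

(** The maps whose conjugate by [L_u] lies in [Dis X] form a permutation group, so generators
    suffice. For [L_x^-1 L_y] the conjugate splits as [(L_u L_x^-1) (L_y L_u^-1)]; a generator
    [L_x L_y^-1] is first rewritten in that form. *)
Lemma Dis_conj u d : @Dis X d -> @Dis X (L u \o d \o l u).
Proof.
have [Dbij D1 DM DV] := Dis_perm_group.
move: d; apply: (@smallest_sub _ _ _ [set d | @Dis X (L u \o d \o l u)]).
  split=> /=.
  - move=> f Df.
    have -> : f = l u \o (L u \o f \o l u) \o L u.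
      by apply/funext => z /=; rewrite !LK.
    by apply: bij_comp => //; apply: bij_comp => //; apply: Dbij.
  - by have -> : L u \o id \o l u = id by apply/funext => z /=; rewrite lK.
  - move=> f g Df Dg.
    have -> : L u \o (f \o g) \o l u = (L u \o f \o l u) \o (L u \o g \o l u).
      by apply/funext => z /=; rewrite LK.
    exact: DM.
  - move=> f g Df [fK gK]; apply: DV Df _.
    by split=> z /=; rewrite LK ?fK ?gK lK.
rewrite dis_generatorsE => f [] [x] [y] -> /=; last first.
  exact: DM (Dis_mul_inv u x) (Dis_mul_inv y u).
rewrite mul_inv_inv_mul.
exact: DM (Dis_mul_inv u (x * y)) (Dis_mul_inv (y * x) u).
Qed.

Lemma isotopic_to_group_regular (G : groupType) :
  isotopic X G -> acts_regularly (@Dis X).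
Proof.
move=> [f [g [h [[f' fK f'K] [g' gK g'K] [h' hK h'K] iso]]]].
pose P := transported_translations G X h h'.
pose Q := transported_translations G X g g'.
have LE x : L x = h' \o (fun z => f x * z) \o g.
  by apply/funext => y /=; rewrite iso hK.
have lE x : l x = g' \o (fun z => (f x)^-1 * z) \o h.
  apply: left_right_inverse_eq (lK x) _ => y; rewrite LE /=.
  by rewrite h'K mulKg gK.
have LlE x y : L x \o l y = h' \o (fun z => f x * (f y)^-1 * z) \o h.
  by apply/funext => z; rewrite LE lE /= g'K mulgA.
have lLQ x y : Q (l x \o L y).
  exists ((f x)^-1 * f y) => //.
  by apply/funext => z; rewrite LE lE /= h'K mulgA.
move=> x0; suff -> : @Dis X = P.
  exact: transported_translations_regular hK h'K x0.
have PLl p : P p -> exists x y, p = L x \o l y.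
  (* As [f] is onto, some [x] satisfies [f x = c * f x0], and [L_x L_{x0}^-1] is then multiplication
     by [c]. *)
  move=> [c _ <-]; exists (f' (c * f x0)), x0.
  by rewrite LlE f'K mulgK.
have PQ : P = Q.
  apply: regular_subset_eq; first by exists.
  - exact: transported_translations_regular.
  - exact: transported_translations_regular.
  - by move=> p /PLl [x [y ->]]; rewrite mul_inv_inv_mul.
(* Generators of the second kind lie in [Q], hence in [P]. *)
apply/seteqP; split; last by move=> p /PLl [x [y ->]]; apply: Dis_mul_inv.
apply: smallest_sub; first exact: transported_translations_perm_group.
rewrite dis_generatorsE => p [] [x] [y] ->; last by rewrite PQ.
by exists (f x * (f y)^-1); rewrite ?LlE.
Qed.

End Rumple.
End Displacements.

(** Let [d a] be the unique element of [A] sending [e] to [a], and take [d a b] as the product.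
    Associativity is [d (d a b) = d a \o d b], where both sides lie in [A] and agree at [e]. *)
Lemma regular_perm_group_transport (T : Type) (A : set (T -> T)) (e : T) :
  is_perm_group A -> acts_regularly A ->
  exists cG : Group.axioms_ T, let G := Group.Pack cG in
    [/\ (1 : G) = e,
        forall a : G, A (fun b : G => a * b : G)
      & forall f, A f -> forall b : G, f b = (f e : G) * b :> G].
Proof.
move=> [Abij A1 AM AV] regA.
have [d hd] := choice (regA e).
have dE f : A f -> d (f e) = f.
  by move=> Af; have [_ dU] := hd (f e); apply: dU.
have Ad a : A (d a) by have [[]] := hd a.
have de a : d a e = a by have [[]] := hd a.
have dM a b : d (d a b) = d a \o d b.
  by rewrite -[in LHS](de b); apply: (dE (d a \o d b)); apply: AM.
have d1 : d e = id by apply: (dE id).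
have [i hi] : exists i : T -> T, forall a, mutually_inverse (d a) (d (i a)).
  have inv a : exists b, mutually_inverse (d a) (d b).
    have [k ak ka] := Abij _ (Ad a).
    by exists (k e); rewrite dE //; apply: AV (Ad a) _.
  by have [i hi] := choice inv; exists i.
have opA : associative d by move=> a b c; rewrite dM.
have op1 : left_id e d by move=> a; rewrite d1.
have opV : left_inverse e i d.
  by move=> a; have [ai _] := hi a; rewrite -{2}(de a) ai.
have opV' : right_inverse e i d.
  by move=> a; have [_ ia] := hi a; rewrite -(de (i a)) ia.
pose C : choiceType := HB.pack T (gen_eqMixin T) (gen_choiceMixin T).
pose isG := isGroup.Build C opA op1 de opV opV'.
pose G : groupType := HB.pack T C isG.
exists (Group.class G); split=> [//|a|f Af b].
  exact: (Ad a).
by rewrite -{1}(dE f Af).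
Qed.

Lemma regular_right_linear_over_group (X : magmaType) :
  inhabited X -> is_latin_rumple X -> acts_regularly (@Dis X) ->
  right_linear_over_group X.
Proof.
move=> [e] [[lqX _ rumple] [_ rqX]] regD.
have [l hl] := left_quasigroup_inverse X lqX.
have [r _ rK] := rqX e.
pose u := r e; have ue : u * e = e by exact: rK.
have luE x : l u (u * x) = x by have [uK _] := hl u; exact: uK.
have lue : l u e = e by rewrite -{1}ue luE.
have [cG [G1 DG GE]] :=
  regular_perm_group_transport X (@Dis X) e (Dis_perm_group X l hl) regD.
exists cG => G.
pose psi : G -> G := left_translation u.
have psiM : {morph psi : a b / a * b}.
  move=> a b.
  (* The conjugate by [L_u] of left multiplication by [a] is in [Dis X] and sends [e] to [psi a], so
     it is left multiplication by [psi a]. *)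
  have := GE _ (Dis_conj X l hl rumple u _ (DG a)) (psi b).
  rewrite /= /left_translation /psi /left_translation luE lue.
  by rewrite -G1 mulg1.
pose psiMult := isMultiplicative.Build G G psi psiM.
pose psi' : {multiplicative G -> G} := HB.pack psi psiMult.
(* [phi x] is the image of [e] under [L_x L_u^-1], which is therefore left multiplication by
   [phi x]. *)
exists (fun x : X => x * l u e), psi' => x y.
have := GE _ (Dis_mul_inv X l hl x u) (psi y).
by rewrite /= /left_translation /psi /left_translation luE.
Qed.

(** The isotopism is [(phi, psi, id)]. Fixing one argument at [e] expresses [phi] and [psi] as a
    translation of [X] followed by a group translation, so both are bijective. *)
Lemma right_linear_over_group_isotopic_to_group (X : magmaType) :
  is_quasigroup X -> right_linear_over_group X -> isotopic_to_group X.
Proof.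
move=> [lqX rqX] [cG /= [phi [psi mulE]]].
pose G := Group.Pack cG; pose e : X := (1 : G).
exists G, phi, psi, id; split=> //; last by exists id.
- apply: (@eq_bij _ _ ((fun a : G => a * (psi e)^-1) \o right_translation e)).
    apply: bij_comp (rqX e).
    by exists (fun a : G => a * psi e) => a; rewrite ?mulgVK ?mulgK.
  by move=> x /=; rewrite /right_translation mulE mulgK.
- have psiE : ((fun a : G => (phi e : G)^-1 * a) \o @left_translation X e
               : X -> G) =1 psi.
    by move=> x; rewrite /= /left_translation mulE mulKg.
  apply: eq_bij psiE; apply: bij_comp (lqX e).
  by exists (fun a : G => (phi e : G) * a) => a; rewrite ?mulVKg ?mulKg.
Qed.

Theorem theorem5p3 (X : magmaType) (hX0 : inhabited X)
    (hX : is_latin_rumple X) :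
  [<-> right_linear_over_group X;
       isotopic_to_group X;
       acts_regularly (@Dis X)].
Proof.
have [[lqX _ rumple] qX] := hX.
tfae.
- exact: right_linear_over_group_isotopic_to_group.
- have [l hl] := left_quasigroup_inverse X lqX.
  by move=> [G isoG]; apply: isotopic_to_group_regular hl rumple G isoG.
- exact: regular_right_linear_over_group.
Qed.
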